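(* Let $X$ be a Banach space and let $G \subseteq \mathcal{L}(X)$ be a compact topological group of isometries acting on $X$. Let $\varphi \colon X \to \,]0,+\infty]$ be proper, lower semicontinuous, bounded below, $G$-invariant, and convex with respect to $G$. Then, given $\epsilon>0$ and $\delta>0$, there exists a $G$-invariant point $\tilde{x}\in X$ such that \[ \varphi(\tilde{x}) < \varphi(x) + \epsilon\Vert x-\tilde{x}\Vert \quad \text{for all } x\in X,\ x\neq \tilde{x}. \] Moreover, if $x_0\in X$ satisfies $\varphi(x_0) < \inf\{\varphi(x) \mid x\in X\}+\delta$, then $\tilde{x}$ can be chosen so that \[ \Vert \overline{x_0}-\tilde{x}\Vert < \frac{\delta}{\epsilon}. \]
   Context: $\mathcal{L}(X)$ is the space of continuous linear maps $X\to X$ with the operator norm topology; $G\subseteq \mathcal{L}(X)$ is a group (under composition) of invertible bounded linear maps with the relative topology, and $\mu$ is the normalized Haar measure on the compact group $G$. A point $x\in X$ is $G$-invariant if $g(x)=x$ for all $g\in G$. A function $\varphi$ on $X$ is $G$-invariant if $\varphi(g(x))=\varphi(x)$ for all $x\in X$, $g\in G$. For $x\in X$, the $G$-symmetrization of $x$ is $\overline{x}=\int_G g(x)\,d\mu(g)$ (Bochner integral). A (possibly $+\infty$-valued) function $\varphi$ is convex with respect to $G$ if $\varphi\left(\int_G g(x)\,d\mu(g)\right)\le \int_G \varphi(g(x))\,d\mu(g)$ for all $x\in X$. ''Proper'' means that $\varphi$ never takes the value $-\infty$ and is not identically $+\infty$. Lower semicontinuous means that $\{x \mid \varphi(x)\le\lambda\}$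 is closed for every $\lambda\in\mathbb{R}$. *)

(* Defs.v *)
From HB Require Import structures.
From mathcomp Require Import all_boot all_order all_algebra.
From mathcomp Require Import all_classical all_reals all_analysis.

Set Implicit Arguments.
Unset Strict Implicit.
Unset Printing Implicit Defensive.

Import Order.TTheory GRing.Theory Num.Theory.
Import numFieldNormedType.Exports.

Local Open Scope classical_set_scope.
Local Open Scope ring_scope.

Section ContinuousLinearMaps.
Context {R : realType} {X : normedModType R}.

Definition cont_linear : {pred X -> X} :=
  fun f => `[< linear f /\ continuous f >].

Lemma cont_linear_submod : submod_closed cont_linear.
Proof.
split=> [|a f g /asboolP[lf cf] /asboolP[lg cg]]; apply/asboolP; split.
- by move=> a u v; rewrite /= scaler0 addr0.
- exact: cst_continuous.
- move=> b u v; change (a *: f (b *: u + v) + g (b *: u + v) =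
    b *: (a *: f u + g u) + (a *: f v + g v)).
  rewrite lf lg !scalerDr !scalerA (mulrC b) -!addrA; congr (_ + _).
  by rewrite addrCA.
- by move=> x; apply: cvgD; [apply: cvgZr; exact: cf | exact: cg].
Qed.

HB.instance Definition _ :=
  GRing.isSubmodClosed.Build R (X -> X) cont_linear cont_linear_submod.

End ContinuousLinearMaps.

(* [clmap X] is L(X). *)
Record clmap (R : realType) (X : normedModType R) :=
  CLMap { clmap_fun :> X -> X ; clmapP : clmap_fun \in cont_linear }.

Section OperatorNorm.
Context {R : realType} {X : normedModType R}.
Implicit Types f g h : clmap X.

HB.instance Definition _ := [isSub for @clmap_fun R X].
HB.instance Definition _ := [Choice of clmap X by <:].
HB.instance Definition _ := [SubChoice_isSubLmodule of clmap X by <:].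

Lemma clmap_linear f : linear f.
Proof. by case/asboolP: (clmapP f). Qed.

Lemma clmap_continuous f : continuous f.
Proof. by case/asboolP: (clmapP f). Qed.

Lemma clmap_inj f g : f =1 g -> f = g.
Proof. by move=> fg; apply/val_inj/funext. Qed.

HB.instance Definition _ f :=
  GRing.isLinear.Build R X X _ (clmap_fun f) (clmap_linear f).

Definition opnorm f : R := sup [set `|f x| | x in [set x | `|x| <= 1]].

Lemma opnorm_has_sup f : has_sup [set `|f x| | x in [set x | `|x| <= 1]].
Proof.
split; first by exists `|f 0|; exists 0 => //=; rewrite normr0.
have /bounded_funP /(_ 1)[M fM] : bounded_near f (nbhs (0 : X)).
  exact/linear_bounded_continuous/clmap_continuous.
by exists M => _ [x x1 <-]; exact: fM.
Qed.

Lemma opnorm_ub f x : `|x| <= 1 -> `|f x| <= opnorm f.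
Proof.
by move=> x1; apply: ub_le_sup; [case: (opnorm_has_sup f)|exists x].
Qed.

Lemma opnorm_le f M : (forall x, `|x| <= 1 -> `|f x| <= M) -> opnorm f <= M.
Proof.
move=> fM; apply: ge_sup; first by case: (opnorm_has_sup f).
by move=> _ [x x1 <-]; exact: fM.
Qed.

Lemma opnormD f g : opnorm (f + g) <= opnorm f + opnorm g.
Proof.
apply: opnorm_le => x x1; change (`|f x + g x| <= opnorm f + opnorm g).
by rewrite (le_trans (ler_normD _ _))// lerD// opnorm_ub.
Qed.

Lemma opnorm_eq0 f : opnorm f = 0 -> f = 0.
Proof.
move=> f0; apply: clmap_inj => x; change (f x = 0).
have [->|x0] := eqVneq x 0; first by rewrite linear0.
have nx : `|x| != 0 by rewrite normr_eq0.
have : `|f (`|x|^-1 *: x)| <= 0.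
  by rewrite -f0 opnorm_ub// normrZ normfV normr_id mulVf.
rewrite normr_le0 linearZ/= scaler_eq0 invr_eq0 (negbTE nx)/=.
by move/eqP.
Qed.

Lemma opnormZ (a : R) f : opnorm (a *: f) = `|a| * opnorm f.
Proof.
have le (b : R) g : opnorm (b *: g) <= `|b| * opnorm g.
  apply: opnorm_le => x x1; change (`|b *: g x| <= `|b| * opnorm g).
  by rewrite normrZ ler_wpM2l// opnorm_ub.
apply/eqP; rewrite eq_le le/=.
have [->|a0] := eqVneq a 0.
  rewrite normr0 mul0r (le_trans (normr_ge0 ((0 *: f) 0)))//.
  by rewrite opnorm_ub// normr0.
rewrite -ler_pdivlMl ?normr_gt0// -normfV.
by rewrite -{1}(scale1r f) -(mulVf a0) -scalerA le.
Qed.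

(* The topology of [clmap X] is the one of the operator norm. *)
HB.instance Definition _ :=
  Lmodule_isNormed.Build R (clmap X) opnormD opnormZ opnorm_eq0.

Lemma clid_subproof : (idfun : X -> X) \in cont_linear.
Proof. by apply/asboolP; split=> [//|x]; exact: cvg_id. Qed.

Definition clid : clmap X := CLMap clid_subproof.

Lemma clcomp_subproof f g : (f \o g : X -> X) \in cont_linear.
Proof.
apply/asboolP; split=> [a u v|x]; first by rewrite /= !linearP.
by apply: continuous_comp; exact: clmap_continuous.
Qed.

Definition clcomp f g : clmap X := CLMap (clcomp_subproof f g).

End OperatorNorm.

(* Groups (under composition) of invertible elements of L(X). *)
Record clgroup (R : realType) (X : normedModType R) := CLGroup {
  clgroup_set : set (clmap X) ;
  clgroup_id : clgroup_set clid ;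
  clgroup_comp : forall g h,
    clgroup_set g -> clgroup_set h -> clgroup_set (clcomp g h) ;
  clgroup_inv : forall g, clgroup_set g ->
    exists h, [/\ clgroup_set h, clcomp h g = clid & clcomp g h = clid] }.

(* The underlying type of a group G, with the relative topology. *)
Definition clgroup_elt (R : realType) (X : normedModType R) (G : clgroup X) :=
  set_type (clgroup_set G).

Section GroupElements.
Context {R : realType} {X : normedModType R} (G : clgroup X).

HB.instance Definition _ := Topological.on (clgroup_elt G).

Definition elt_id : clgroup_elt G := exist _ clid (mem_set (clgroup_id G)).

HB.instance Definition _ := isPointed.Build (clgroup_elt G) elt_id.

Definition elt_mul (g h : clgroup_elt G) : clgroup_elt G :=
  exist _ (clcomp (val g) (val h))
    (mem_set (clgroup_comp (set_mem (valP g)) (set_mem (valP h)))).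

End GroupElements.

Notation borel G := (g_sigma_algebraType (@open (clgroup_elt G))).

(* A left-invariant Borel probability measure on G. When G is compact this is
   its normalized Haar measure: in a metric space a finite Borel measure is
   automatically regular, and invariance determines it uniquely. *)
Definition is_haar (R : realType) (X : normedModType R) (G : clgroup X)
    (mu : probability (borel G) R) : Prop :=
  forall (g : clgroup_elt G) (A : set (borel G)), measurable A ->
    mu [set elt_mul g h | h in A] = mu A.

Section Bochner.
Context d (T : measurableType d) (R : realType) (X : normedModType R).
Variable mu : {measure set T -> \bar R}.

Definition simple_fun (s : T -> X) : Prop :=
  [/\ finite_set (range s),
      forall y, measurable (s @^-1` [set y]) &
      forall y, y != 0 -> (mu (s @^-1` [set y]) < +oo)%E].

Definition simple_integral (s : T -> X) : X :=
  \sum_(y \in range s) fine (mu (s @^-1` [set y])) *: y.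

(* The a.e. convergence makes f strongly measurable. *)
Definition is_bochner_integral (f : T -> X) (v : X) : Prop :=
  exists s : nat -> T -> X,
    [/\ forall n, simple_fun (s n),
        {ae mu, forall t, s n t @[n --> \oo] --> f t},
        (\int[mu]_t (`|f t - s n t|)%:E)%E @[n --> \oo] --> (0 : \bar R) &
        simple_integral (s n) @[n --> \oo] --> v].

(* 0 when f is not Bochner integrable. *)
Definition bochner_integral (f : T -> X) : X :=
  xget 0 [set v | is_bochner_integral f v].

End Bochner.

Section Symmetrization.
Context {R : realType} {X : normedModType R} (G : clgroup X).
Implicit Types (mu : probability (borel G) R) (phi : X -> \bar R).

Definition symmetrization mu (x : X) : X :=
  bochner_integral mu (fun g : borel G => val g x).

Definition invariant_point (x : X) : Prop :=
  forall g : clmap X, clgroup_set G g -> g x = x.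

Definition invariant_fun phi : Prop :=
  forall (g : clmap X) x, clgroup_set G g -> phi (g x) = phi x.

Definition convex_wrt mu phi : Prop :=
  forall x, (phi (symmetrization mu x) <=
    \int[mu]_(g in [set: borel G]) phi (val g x))%E.

End Symmetrization.

Section ExtendedRealFunctions.
Context {R : realType} {X : normedModType R}.
Implicit Types phi : X -> \bar R.

Definition proper_fun phi : Prop :=
  (forall x, phi x != -oo%E) /\ exists x, phi x != +oo%E.

(* Closed sublevel sets, equivalent to the library's [lower_semicontinuous]. *)
Definition lsc phi : Prop :=
  forall l : R, closed [set x | (phi x <= l%:E)%E].

Definition bounded_below phi : Prop :=
  exists m : R, forall x, (m%:E <= phi x)%E.

End ExtendedRealFunctions.

(* Main.v *)
(* Symmetrization x |-> xbar maps X into the closed set of invariant points (by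
   Haar invariance), satisfies |xbar - w| <= |x - w| for invariant w (since G
   acts by isometries), and does not increase phi (by convexity and
   invariance). So Ekeland's principle, applied to phi on the invariant points
   from the symmetrization of x0, gives a point xt; comparing xt with xbar
   instead of x extends its strict minimality to all of X. *)

Require Import Defs.
From mathcomp Require Import all_boot all_order all_algebra.
From mathcomp Require Import all_classical all_reals all_analysis.
From mathcomp Require Import finmap measurable_realfun lra.

Set Implicit Arguments.
Unset Strict Implicit.
Unset Printing Implicit Defensive.

Import Order.TTheory GRing.Theory Num.Theory.
Import numFieldNormedType.Exports.

Local Open Scope classical_set_scope.
Local Open Scope ring_scope.

(** * Ekeland's variational principle on a subset of a Banach space *)

Lemma cauchy_seq_cvg (R : realType) (X : completeNormedModType R) (u : nat -> X) :
  (forall e : R, 0 < e -> exists N, forall m n,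
    (N <= m)%N -> (N <= n)%N -> `|u m - u n| <= e) ->
  cvgn u.
Proof.
move=> cu; apply/cauchy_cvgP/cauchy_exP => e e0.
have [|N uN] := cu (e / 2); first exact: divr_gt0.
exists (u N), N => // n /= Nn; rewrite -ball_normE /=.
by rewrite (le_lt_trans (uN _ _ _ _))// ltr_pdivrMr// ltr_pMr// ltr1n.
Qed.

(** Order points by [F y + eps * |x - y| <= F x] and descend through near-minimizers of [F]: the
    sets of successors shrink to one point, which is minimal. With [F] real-valued on a set [D],
    this [D] can encode both finiteness and a side constraint. *)
Lemma ekeland (R : realType) (X : completeNormedModType R) (D : set X)
    (F : X -> R) (b eps : R) (x0 : X) :
  (forall x, D x -> b <= F x) ->
  (forall l, closed [set x | D x /\ F x <= l]) ->
  0 < eps -> D x0 ->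
  exists xt, [/\ D xt, F xt + eps * `|x0 - xt| <= F x0 &
    forall z, D z -> z != xt -> F xt < F z + eps * `|z - xt|].
Proof.
move=> bF lscF eps0 Dx0.
pose S x := [set y | D y /\ F y + eps * `|x - y| <= F x].
have Sxx x : D x -> S x x by move=> Dx; split=> //; rewrite subrr normr0 mulr0 addr0.
have Strans x y z : S x y -> S y z -> S x z.
  move=> [Dy xy] [Dz yz]; split=> //.
  have : eps * `|x - z| <= eps * `|x - y| + eps * `|y - z|.
    by rewrite -mulrDr ler_pM2l// ler_distD.
  by lra.
(* The first component of [nx] is the stage, which fixes the tolerance of the near-minimizer.
   Outside [D] the value 0 is a dummy that makes the relation total for [choice]. *)
have next (nx : nat * X) : exists y, D nx.2 -> S nx.2 y /\
    forall z, S nx.2 z -> F y <= F z + nx.1.+1%:R^-1.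
  have [Dx|] := pselect (D nx.2); last by exists 0.
  have n0 : 0 < nx.1.+1%:R^-1 :> R by rewrite invr_gt0 ltr0n.
  have hi : has_inf (F @` S nx.2).
    split; first by exists (F nx.2), nx.2 => //; exact: Sxx.
    by exists b => _ [y [Dy _] <-]; exact: bF.
  have [_ [y Sy <-] ylt] := inf_adherent n0 hi.
  exists y => _; split=> // z Sz; rewrite (le_trans (ltW ylt))// lerD2r.
  by apply: ge_inf; [case: hi|exists z].
have [nxt nxtP] := choice next.
pose u := fix u n := if n is m.+1 then nxt (m, u m) else x0.
have Du n : D (u n).
  by elim: n => // n /(nxtP (n, u n))[[]].
have uS n k : S (u n) (u (n + k)%N).
  elim: k => [|k IH]; first by rewrite addn0; exact: Sxx.
  by rewrite addnS; apply: Strans IH _; have [] := nxtP ((n + k)%N, u (n + k)%N) (Du _).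
have {nxtP} uP n : S (u n) (u n.+1) /\
    forall z, S (u n) z -> F (u n.+1) <= F z + n.+1%:R^-1.
  exact: nxtP (n, u n) (Du n).
(* By transitivity [z] also competed when [u n.+1] was chosen, so [F] can drop by at most the
   tolerance from [u n.+1] to [z]; this drop dominates [eps] times the distance. *)
have near_next n z : S (u n.+1) z -> eps * `|u n.+1 - z| <= n.+1%:R^-1.
  move=> Sz; have [Snn /(_ z)] := uP n.
  move=> /(_ (Strans _ _ _ Snn Sz)); case: Sz => _.
  by rewrite -lerBrDl => /le_trans h; rewrite -lerBlDl; exact: h.
have small (e : R) : 0 < e -> exists N, forall n z, (N <= n)%N ->
    S (u n) z -> `|u n - z| <= e.
  move=> e0; have [N _ Ne] := near_infty_natSinv_lt (PosNum (mulr_gt0 eps0 e0)).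
  (* The index is shifted since the starting point [u 0] is not a near-minimizer: the estimate only
     holds from [u 1] on. *)
  exists N.+1 => -[//|n] z Nn Sz.
  by rewrite -(ler_pM2l eps0) (le_trans (near_next _ _ Sz))// ltW//; exact: Ne.
have cu : cvgn u.
  apply: cauchy_seq_cvg => e e0.
  have [N sN] := small _ (divr_gt0 e0 (ltr0n R 2)).
  exists N => m n Nm Nn.
  have := sN N (u m) (leqnn _); rewrite -{1}(subnKC Nm) => /(_ (uS _ _)).
  have := sN N (u n) (leqnn _); rewrite -{1}(subnKC Nn) => /(_ (uS _ _)).
  have := ler_distD (u N) (u m) (u n); rewrite (distrC (u m) (u N)); lra.
pose xt := limn u.
have ut : u @ \oo --> xt by [].
have Sxt m : S (u m) xt.
  (* Closedness is available for a fixed level only, whereas the bound on [F (u n)] involves |u m -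
     u n|. The slack [e] absorbs the replacement of [u n] by [xt] in that distance, and then tends
     to 0. *)
  have main (e : R) : 0 < e -> D xt /\ F xt <= F (u m) - eps * `|u m - xt| + e.
    move=> e0; apply: (closed_cvg _ (lscF (F (u m) - eps * `|u m - xt| + e)) _ _ ut).
    have /cvgrPdist_le/(_ (e / eps))/(_ (divr_gt0 e0 eps0)) utd := ut.
    near=> n; split=> //.
    have mn : (m <= n)%N by near: n; exact: nbhs_infty_ge.
    have [_] := uS m (n - m)%N; rewrite subnKC//.
    have : `|xt - u n| <= e / eps by near: n.
    rewrite ler_pdivlMr// mulrC.
    have := ler_distD (u n) (u m) xt; rewrite -(ler_pM2l eps0) mulrDr (distrC (u n) xt).
    lra.
  split; first by have [] := main 1 ltr01.
  rewrite -lerBrDr; apply/ler_addgt0Pr => e e0.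
  by have [] := main e e0.
exists xt; split; [by have [] := Sxt 0%N|by have [] := Sxt 0%N|].
(* A violating [z] would succeed [xt], hence every [u m]; the shrinking successor sets then force
   [u] to converge to [z] as well, so [z = xt]. *)
move=> z Dz zxt; rewrite ltNge; apply/negP => zle.
have Sz m : S (u m) z.
  by apply: Strans (Sxt m) _; split=> //; rewrite distrC.
move/eqP: zxt; apply.
apply: (@cvg_unique _ _ (u @ \oo)) => //.
apply/cvgrPdist_le => e e0; have [N sN] := small e e0.
by exists N => // n /= Nn; rewrite distrC; exact: sN.
Unshelve. all: by end_near. Qed.

(** * Integrals of simple functions for a finite measure *)

Section FiniteMeasureBochner.
Context d (T : measurableType d) (R : realType) (X : normedModType R).
Variable mu : {finite_measure set T -> \bar R}.
Implicit Types (s t : T -> X) (f : T -> X) (A : set T).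

Lemma simple_fun_finite_measure s :
  simple_fun mu s <->
  finite_set (range s) /\ forall y, measurable (s @^-1` [set y]).
Proof.
split=> [[]//|[fs ms]]; split=> // y _.
by rewrite -ge0_fin_numE//; exact: fin_num_measure.
Qed.

Lemma measurable_preimage_simple s A y :
  simple_fun mu s -> measurable A -> measurable (A `&` s @^-1` [set y]).
Proof. by move=> [_ ms _] mA; exact: measurableI. Qed.

Lemma integral_simple_levels s A (h : T -> \bar R) :
  simple_fun mu s -> measurable A -> measurable_fun A h ->
  (forall x, A x -> (0 <= h x)%E) ->
  (\int[mu]_(x in A) h x = \sum_(y <- fset_set (range s))
     \int[mu]_(x in A `&` s @^-1` [set y]) h x)%E.
Proof.
move=> ss mA mh h0; have [fs ms _] := ss.
have AE : \big[setU/set0]_(y <- fset_set (range s)) (A `&` s @^-1` [set y]) = A.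
  rewrite -bigcup_seq -setI_bigcupr setIidl// => x _ /=.
  exists (s x) => //=; rewrite in_fset_set//; apply/mem_set; by exists x.
rewrite -{1}AE ge0_integral_bigsetU ?AE//.
- by move=> y; exact: measurableI.
- by move=> y z _ _ [x [[_ /= <-] [_ /= <-]]].
Qed.

Lemma measure_simple_levels s A : simple_fun mu s -> measurable A ->
  fine (mu A) = \sum_(y <- fset_set (range s)) fine (mu (A `&` s @^-1` [set y])).
Proof.
move=> ss mA; apply: EFin_inj; rewrite -sumEFin fineK ?fin_num_measure//.
have := @integral_simple_levels s A (cst 1%E) ss mA (measurable_cst _) (fun _ _ => lee01).
rewrite integral_cst// mul1e => ->; apply: eq_bigr => y _.
have mAy := measurable_preimage_simple y ss mA.
by rewrite integral_cst// mul1e fineK ?fin_num_measure.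
Qed.

(** Passing to the common refinement of the level sets allows two simple integrals to be subtracted
    cell by cell. *)
Lemma simple_integral_levels s t : simple_fun mu s -> simple_fun mu t ->
  simple_integral mu s = \sum_(y <- fset_set (range s)) \sum_(z <- fset_set (range t))
    fine (mu (s @^-1` [set y] `&` t @^-1` [set z])) *: y.
Proof.
move=> [fs ms _] st; rewrite /simple_integral fsbig_finite//=.
apply: eq_bigr => y _.
by rewrite (measure_simple_levels st (ms y)) scaler_suml.
Qed.

(** On the level set of [s] at [y] the function is |f - y|, and there are finitely many levels.
    Measurability of [f] is expressed through its distances to fixed points, so that no
    sigma-algebra on [X] is involved. *)
Lemma measurable_fun_norm_sub f s :
  (forall w, measurable_fun setT (fun x => `|f x - w|)) -> simple_fun mu s ->
  measurable_fun setT (fun x => `|f x - s x|).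
Proof.
move=> mf [fs ms _] _ B mB; rewrite setTI.
have -> : (fun x => `|f x - s x|) @^-1` B = \bigcup_(y in range s)
    (s @^-1` [set y] `&` (fun x => `|f x - y|) @^-1` B).
  apply/seteqP; split=> [x Bx|x [y _ [/= <-]]//].
  by exists (s x); [exists x|split].
apply: fin_bigcup_measurable => // y _; apply: measurableI => //.
by have := mf y measurableT B mB; rewrite setTI.
Qed.

Lemma measurable_fun_norm_sub_simple s t : simple_fun mu s -> simple_fun mu t ->
  measurable_fun setT (fun x => `|s x - t x|).
Proof.
move=> ss st; apply: measurable_fun_norm_sub st => w.
rewrite (_ : (fun x => _) = (fun x => `|w - s x|)); last first.
  by apply/funext => x; rewrite distrC.
by apply: measurable_fun_norm_sub ss => w'; exact: measurable_cst.
Qed.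

Lemma simple_integral_dist s t : simple_fun mu s -> simple_fun mu t ->
  ((`|simple_integral mu s - simple_integral mu t|)%:E <=
   \int[mu]_x (`|s x - t x|)%:E)%E.
Proof.
move=> ss st; have [_ ms _] := ss.
rewrite (simple_integral_levels ss st) (simple_integral_levels st ss).
rewrite [X in _ - X]exchange_big/= -sumrB.
under eq_bigr do under [X in _ - X]eq_bigr do rewrite setIC.
under eq_bigr do rewrite -sumrB.
have mst := measurable_fun_norm_sub_simple ss st.
rewrite (integral_simple_levels ss measurableT); [|exact/measurable_EFinP|by []].
apply: (@le_trans _ _ (\sum_(y <- fset_set (range s)) \sum_(z <- fset_set (range t))
    fine (mu (s @^-1` [set y] `&` t @^-1` [set z])) * `|y - z|)%:E).
  rewrite lee_fin (le_trans (ler_norm_sum _ _ _))// ler_sum// => y _.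
  rewrite (le_trans (ler_norm_sum _ _ _))// ler_sum// => z _.
  by rewrite -scalerBr normrZ ger0_norm// fine_ge0.
rewrite -sumEFin lee_sum// => y _; rewrite setTI -sumEFin.
rewrite (integral_simple_levels st (ms y)); last 2 first.
- exact/measurable_EFinP/measurable_funTS.
- by [].
apply: lee_sum => z _; have mI := measurable_preimage_simple z st (ms y).
rewrite (eq_integral (cst (`|y - z|)%:E)); last first.
  by move=> x /set_mem[/= -> ->].
by rewrite integral_cst// EFinM fineK ?fin_num_measure// muleC.
Qed.

Lemma simple_integral_dist_approx f s t :
  (forall w, measurable_fun setT (fun x => `|f x - w|)) ->
  simple_fun mu s -> simple_fun mu t ->
  ((`|simple_integral mu s - simple_integral mu t|)%:E <=
   \int[mu]_x (`|f x - s x|)%:E + \int[mu]_x (`|f x - t x|)%:E)%E.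
Proof.
move=> mf ss st; rewrite (le_trans (simple_integral_dist ss st))//.
have mfs := measurable_fun_norm_sub mf ss.
have mft := measurable_fun_norm_sub mf st.
rewrite -ge0_integralD//; [|exact/measurable_EFinP|exact/measurable_EFinP].
apply: ge0_le_integral => //.
- exact/measurable_EFinP/measurable_fun_norm_sub_simple.
- by apply: emeasurable_funD; exact/measurable_EFinP.
- by move=> x _; rewrite -EFinD lee_fin (distrC (f x)) ler_distD.
Qed.

(** Limit form of the previous estimate. With [a = b = 0] it gives uniqueness of the Bochner
    integral; with a constant sequence [t] it bounds the distance from the integral to a point. *)
Lemma simple_integral_lim_dist f (s t : nat -> T -> X) v w (a b : \bar R) :
  (forall u, measurable_fun setT (fun x => `|f x - u|)) ->
  (forall n, simple_fun mu (s n)) -> (forall n, simple_fun mu (t n)) ->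
  (\int[mu]_x (`|f x - s n x|)%:E)%E @[n --> \oo] --> a ->
  (\int[mu]_x (`|f x - t n x|)%:E)%E @[n --> \oo] --> b ->
  (a +? b)%E ->
  simple_integral mu (s n) @[n --> \oo] --> v ->
  simple_integral mu (t n) @[n --> \oo] --> w ->
  ((`|v - w|)%:E <= a + b)%E.
Proof.
move=> mf ss st sa tb ab sv tw.
apply: lee_cvg_to (cvgeD ab sa tb) _; last first.
  by apply: nearW => n; exact: (@simple_integral_dist_approx f (s n) (t n)).
apply: cvg_EFin; first exact: nearW.
by apply: cvg_norm; exact: cvgB.
Qed.

End FiniteMeasureBochner.

(** * Bochner integrals for a probability: norm bound and existence *)

Section ProbabilityBochner.
Context d (T : measurableType d) (R : realType) (X : completeNormedModType R).
Variable P : probability T R.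
Implicit Types (f : T -> X).

Lemma simple_fun_cst (w : X) : simple_fun P (cst w : T -> X).
Proof.
apply/simple_fun_finite_measure; split.
  by apply: (sub_finite_set _ (finite_set1 w)) => _ [x _ <-].
by move=> y; rewrite preimage_cst; case: ifP.
Qed.

Lemma simple_integral_cst (w : X) : simple_integral P (cst w : T -> X) = w.
Proof.
rewrite /simple_integral (_ : range _ = [set w]).
  by rewrite fsbig_set1 preimage_cst mem_set//= probability_setT scale1r.
by apply/seteqP; split=> [_ [x _ <-]//|_ ->]; exists point.
Qed.

(** The constant function [w] is simple and, the total mass being 1, integrates to [w]; compare the
    approximants of [f] with it. *)
Lemma bochner_integral_dist_le f v w c :
  (forall u, measurable_fun setT (fun x => `|f x - u|)) ->
  is_bochner_integral P f v -> (forall x, `|f x - w| <= c) -> `|v - w| <= c.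
Proof.
move=> mf [s [ss _ sf sv]] fw; rewrite -lee_fin.
have sw := @simple_fun_cst w.
have Iw : (\int[P]_x (`|f x - w|)%:E <= c%:E)%E.
  rewrite -[leRHS]mule1 -(@probability_setT _ _ _ P) -integral_cst//.
  apply: ge0_le_integral => //.
  - exact/measurable_EFinP.
  - by move=> x _; rewrite lee_fin.
rewrite (le_trans _ Iw)// -[leRHS]add0e.
apply: (simple_integral_lim_dist (t := fun=> cst w) mf ss _ sf _ _ sv) => //.
- exact: cvg_cst.
- by under eq_fun do rewrite simple_integral_cst; exact: cvg_cst.
Qed.

(** Induction on [l]: each [x] is sent to the first point of the list within [e] of [f x], and to 0
    if there is none. *)
Lemma simple_approximation f (l : seq X) (e : R) :
  (forall w, measurable_fun setT (fun x => `|f x - w|)) ->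
  exists s, simple_fun P s /\
    forall x, (exists2 y, y \in l & `|f x - y| < e) -> `|f x - s x| < e.
Proof.
move=> mf; elim: l => [|y l [s [ss IH]]].
  by exists (cst 0); split=> [|x []//]; exact: simple_fun_cst.
pose U := [set x | `|f x - y| < e].
have mU : measurable U.
  have := mf y measurableT `]-oo, e[%classic (measurable_itv _).
  by rewrite setTI; congr measurable; apply/seteqP; split=> x; rewrite /= in_itv.
exists (fun x => if `|f x - y| < e then y else s x); split; last first.
  move=> x [z]; rewrite inE; case: ifPn => [//|fy] /predU1P[->|zl] fz.
    by rewrite fz in fy.
  by apply: IH; exists z.
have /simple_fun_finite_measure[fs ms] := ss.
apply/simple_fun_finite_measure; split.
  apply: (sub_finite_set _ (_ : finite_set (y |` range s))).
    by move=> _ [x _ <-] /=; case: ifPn => _; [left|right; exists x].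
  by rewrite finite_setU; split=> //; exact: finite_set1.
move=> z; rewrite (_ : _ @^-1` _ =
    (U `&` [set _ | y = z]) `|` (~` U `&` s @^-1` [set z])).
  apply: measurableU; apply: measurableI => //; last exact: measurableC.
  have [yz|yz] := pselect (y = z).
    by rewrite (_ : [set _ | _] = setT)//; apply/seteqP; split.
  by rewrite (_ : [set _ | _] = set0)//; apply/seteqP; split.
apply/seteqP; split=> x; rewrite /U /=.
  by case: ifPn => [?|/negP ?] <-; [left|right].
by case: ifPn => [? [[]//|[]//]|? [[]//|[]//]].
Qed.

(** A totally bounded range yields simple functions uniformly within [1/(n+1)] of [f]; their
    integrals form a Cauchy sequence, which converges by completeness. *)
Lemma bochner_integral_exists f :
  (forall w, measurable_fun setT (fun x => `|f x - w|)) ->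
  (forall e, 0 < e -> exists l : seq X,
    forall x, exists2 y, y \in l & `|f x - y| < e) ->
  exists v, is_bochner_integral P f v.
Proof.
move=> mf tb.
have approx (n : nat) : exists s, simple_fun P s /\ forall x, `|f x - s x| < n.+1%:R^-1.
  have n0 : 0 < n.+1%:R^-1 :> R by rewrite invr_gt0 ltr0n.
  have [l lP] := tb _ n0; have [s [ss sP]] := simple_approximation l n.+1%:R^-1 mf.
  by exists s; split=> // x; exact: sP.
have [s sP] := choice approx.
have ss n : simple_fun P (s n) by case: (sP n).
have sf n x : `|f x - s n x| <= n.+1%:R^-1 by case: (sP n) => _ /(_ x)/ltW.
have Isf n : (\int[P]_x (`|f x - s n x|)%:E <= n.+1%:R^-1%:E)%E.
  rewrite -[leRHS]mule1 -(@probability_setT _ _ _ P) -integral_cst//.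
  apply: ge0_le_integral => //.
  - exact/measurable_EFinP/(measurable_fun_norm_sub mf (ss n)).
  - by move=> x _; rewrite lee_fin.
have cvg0 : n.+1%:R^-1 @[n --> \oo] --> (0 : R) by exact: cvg_harmonic.
have /cvg_ex[v sv] : cvgn (fun n => simple_integral P (s n)).
  apply: cauchy_seq_cvg => e e0.
  have [N _ Ne] := near_infty_natSinv_lt (PosNum (divr_gt0 e0 (ltr0n R 2))).
  exists N => m n Nm Nn; rewrite -lee_fin.
  rewrite (le_trans (simple_integral_dist_approx mf (ss m) (ss n)))//.
  rewrite [e]splitr EFinD leeD// (le_trans (Isf _))// lee_fin ltW//; exact: Ne.
exists v, s; split=> //.
- apply: aeW => x; apply/cvgrPdist_le => e e0.
  have [N _ Ne] := near_infty_natSinv_lt (PosNum e0).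
  by exists N => // n /= Nn; rewrite (le_trans (sf _ _))// ltW//; exact: Ne.
- apply: (@squeeze_cvge _ _ _ _ (cst 0%E) _ (fun n => n.+1%:R^-1%:E)).
  + by apply: nearW => n; rewrite integral_ge0//= Isf.
  + exact: cvg_cst.
  + by apply: cvg_EFin => //; exact: nearW.
Qed.

End ProbabilityBochner.

(** * Continuity and measurability of the group action *)

Lemma lipschitz_continuous (R : realType) (V W : normedModType R) (F : V -> W) (k : R) :
  (forall x y, `|F x - F y| <= k * `|x - y|) -> continuous F.
Proof.
move=> Fk x; apply/cvgrPdist_le => e e0.
have k0 : 0 < `|k| + 1 by rewrite ltr_wpDl.
have /cvgrPdist_le/(_ _ (divr_gt0 e0 k0)) := @cvg_id _ (nbhs x).
apply: filterS => y; rewrite ler_pdivlMr// mulrC; apply: le_trans.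
by rewrite (le_trans (Fk _ _))// ler_wpM2r// (le_trans (ler_norm k))// lerDl.
Qed.

Section GroupTopology.
Context {R : realType} {X : normedModType R}.
Implicit Types (f g h : clmap X).

Lemma ler_opnorm f x : `|f x| <= opnorm f * `|x|.
Proof.
have [->|x0] := eqVneq x 0; first by rewrite linear0 !normr0 mulr0.
have nx : 0 < `|x| by rewrite normr_gt0.
rewrite -ler_pdivrMr// (_ : _ / _ = `|f (`|x|^-1 *: x)|); last first.
  by rewrite linearZ normrZ normfV normr_id mulrC.
by rewrite opnorm_ub// normrZ normfV normr_id mulVf// gt_eqF.
Qed.

Lemma clmap_eval_continuous x : continuous (fun f : clmap X => f x).
Proof.
apply: (@lipschitz_continuous R (clmap X) X _ `|x|) => f g.
by rewrite mulrC; exact: (ler_opnorm (f - g)).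
Qed.

Lemma clcomp_continuous h : continuous (clcomp h).
Proof.
apply: (@lipschitz_continuous R (clmap X) (clmap X) _ (opnorm h)) => f g.
apply: opnorm_le => x x1; change (`|h (f x) - h (g x)| <= opnorm h * opnorm (f - g)).
rewrite -linearB (le_trans (ler_opnorm _ _))// ler_wpM2l ?(normr_ge0 h)//.
exact: (opnorm_ub (f - g)).
Qed.

Variable G : clgroup X.

Lemma elt_val_continuous : continuous (val : clgroup_elt G -> clmap X).
Proof. exact: initial_continuous. Qed.

Lemma elt_eval_continuous x : continuous (fun g : clgroup_elt G => val g x).
Proof.
move=> g; apply: (@continuous_comp (clgroup_elt G) (clmap X) X val (fun f => f x)).
  exact: elt_val_continuous.
exact: clmap_eval_continuous.
Qed.

Lemma elt_eval_dist_continuous x w :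
  continuous (fun g : clgroup_elt G => `|val g x - w|).
Proof.
have cn : continuous (fun y : X => `|y - w|).
  by move=> y; apply: cvg_norm; apply: cvgB; [exact: cvg_id|exact: cvg_cst].
by move=> g; have := continuous_comp (@elt_eval_continuous x g) (cn _).
Qed.

Lemma elt_mul_continuous (h : clgroup_elt G) : continuous (elt_mul h).
Proof.
apply/continuousP => _ [B oB <-].
exists (clcomp (val h) @^-1` B) => //.
by move/continuousP: (@clcomp_continuous (val h)); apply.
Qed.

Lemma measurable_elt_mul (h : borel G) :
  measurable_fun setT (elt_mul h : borel G -> borel G).
Proof.
apply: (@measurability _ _ (borel G) (borel G) _ _ (@open (clgroup_elt G)) erefl).
move=> _ [B oB <-]; rewrite setTI; apply: sub_sigma_algebra.
by move/continuousP: (@elt_mul_continuous h); apply.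
Qed.

Lemma measurable_elt_eval_norm (x w : X) :
  measurable_fun setT (fun g : borel G => `|val g x - w|).
Proof.
apply: (measurability _ (RGenOpens.measurableE R)).
move=> _ [_ [a [b ->] <-]]; rewrite setTI; apply: sub_sigma_algebra.
by move/continuousP: (@elt_eval_dist_continuous x w); apply; exact: interval_open.
Qed.

(** The orbit of [x] is a continuous image of the compact group; the centers come from a finite
    subcover by preimages of balls centered on the orbit. *)
Lemma elt_eval_totally_bounded (x : X) (e : R) :
  compact [set: clgroup_elt G] -> 0 < e ->
  exists l : seq X, forall g : borel G, exists2 y, y \in l & `|val g x - y| < e.
Proof.
rewrite compact_cover => cG e0.
pose U (g0 : clgroup_elt G) := [set g : clgroup_elt G | `|val g x - val g0 x| < e].
have [| |D' _ D'P] := cG (clgroup_elt G) setT U.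
- move=> g0 _.
  by have /continuousP/(_ _ (@open_lt _ e)) := @elt_eval_dist_continuous x (val g0 x).
- by move=> g _; exists g => //; rewrite /U /= subrr normr0.
exists [seq val g x | g : clgroup_elt G <- D'] => g.
have [g0 /= g0D gg0] := D'P g Logic.I.
by exists (val g0 x) => //; apply: map_f.
Qed.

End GroupTopology.

(** * Symmetrization over the Haar measure *)

Section SymmetrizationTheory.
Context {R : realType} {X : completeNormedModType R} (G : clgroup X).
Hypothesis compactG : compact [set: clgroup_elt G].
Hypothesis isomG : forall g : clmap X, clgroup_set G g ->
  forall x y, `|g x - g y| = `|x - y|.
Variable mu : probability (borel G) R.

Lemma elt_clgroup_set (g : borel G) : clgroup_set G (val g).
Proof. exact: set_mem (valP g). Qed.

Lemma elt_clgroup_setv (g : clgroup_elt G) : exists h : clgroup_elt G,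
  (forall x, val h (val g x) = x) /\ (forall x, val g (val h x) = x).
Proof.
have [h [Gh hg gh]] := clgroup_inv (elt_clgroup_set g).
exists (exist _ h (mem_set Gh)); split=> x /=.
  by rewrite -[RHS]/(clid x) -hg.
by rewrite -[RHS]/(clid x) -gh.
Qed.

(** Compactness makes orbit maps Bochner integrable, so [xget] returns a genuine integral and not
    its default 0. *)
Lemma is_bochner_integral_symmetrization (x : X) :
  is_bochner_integral mu (fun g : borel G => val g x) (symmetrization mu x).
Proof.
apply: xgetPex; apply: bochner_integral_exists; first exact: measurable_elt_eval_norm.
by move=> e e0; exact: elt_eval_totally_bounded.
Qed.

(** Each orbit point is as far from [w] as [x] is, since [g w = w] and [g] is an isometry; averaging
    keeps this bound. *)
Lemma symmetrization_dist_le (x w : X) : invariant_point G w ->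
  `|symmetrization mu x - w| <= `|x - w|.
Proof.
move=> iw; apply: bochner_integral_dist_le (is_bochner_integral_symmetrization x) _.
  exact: measurable_elt_eval_norm.
by move=> g; rewrite -{1}(iw _ (elt_clgroup_set g)) isomG//; exact: elt_clgroup_set.
Qed.

Lemma symmetrization_fun_le (phi : X -> \bar R) (x : X) :
  invariant_fun G phi -> convex_wrt mu phi ->
  (phi (symmetrization mu x) <= phi x)%E.
Proof.
move=> iphi /(_ x) /le_trans; apply.
rewrite (eq_integral (cst (phi x))); last first.
  by move=> g _; rewrite iphi//; exact: elt_clgroup_set.
by rewrite integral_cst//= probability_setT mule1.
Qed.

Hypothesis haar_mu : is_haar mu.

(** [is_haar] speaks of direct images; translation by [k] is onto, so it maps the preimage of [A]
    exactly onto [A]. *)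
Lemma haar_preimage (k : clgroup_elt G) (A : set (borel G)) :
  measurable A -> mu (elt_mul k @^-1` A) = mu A.
Proof.
move=> mA; have mB : measurable (elt_mul k @^-1` A : set (borel G)).
  by rewrite -[X in measurable X]setTI; exact: measurable_elt_mul.
rewrite -(haar_mu k mB); congr (mu _); apply/seteqP; split=> [_ [g Ag <-]//|g Ag].
have [h [_ kh]] := elt_clgroup_setv k.
have E : elt_mul k (elt_mul h g) = g by apply/val_inj/clmap_inj => x; exact: kh.
by exists (elt_mul h g) => //=; rewrite E.
Qed.

(** Change of variables: [mu] is its own pushforward under left translation. *)
Lemma haar_integral_elt_mul (k : clgroup_elt G) (f : borel G -> \bar R) :
  measurable_fun setT f -> (forall g, (0 <= f g)%E) ->
  (\int[mu]_g f (elt_mul k g) = \int[mu]_g f g)%E.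
Proof.
move=> mf f0.
rewrite -(@ge0_integral_pushforward _ _ _ _ _ _ (measurable_elt_mul k) mu setT f)//.
apply: eq_measure_integral => [|mk A mA _]; first exact: measurable_elt_mul.
exact: haar_preimage.
Qed.

Lemma symmetrization_invariant (x : X) : invariant_point G (symmetrization mu x).
Proof.
move=> h Gh; pose hE : clgroup_elt G := exist _ h (mem_set Gh).
have [k [kh hk]] := elt_clgroup_setv hE.
have [s [ss _ sf sv]] := is_bochner_integral_symmetrization x.
(* The h-translates of s n integrate to h (\int s n) and approximate the same
   orbit map, so h fixes the integral by uniqueness. *)
pose t n : borel G -> X := fun g => h (s n (elt_mul k g)).
have preim n y : t n @^-1` [set y] = elt_mul k @^-1` (s n @^-1` [set val k y]).
  apply/seteqP; split=> g /=; rewrite /t.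
    by move=> <-; rewrite kh.
  by move=> ->; exact: hk.
have surjk (g : clgroup_elt G) : elt_mul k (elt_mul hE g) = g.
  by apply/val_inj/clmap_inj => z; exact: kh.
have ranget n : range (t n) = h @` range (s n).
  apply/seteqP; split=> [_ [g _ <-]|_ [_ [g _ <-] <-]].
    by exists (s n (elt_mul k g)) => //; exists (elt_mul k g).
  by exists (elt_mul hE g) => //; rewrite /t surjk.
have st n : simple_fun mu (t n).
  have [fs ms _] := ss n; apply/simple_fun_finite_measure; split.
    by rewrite ranget; exact: finite_image.
  move=> y; rewrite preim -[X in measurable X]setTI.
  by apply: measurable_elt_mul.
(* Injectivity of [h] matches the values of [t n] with those of [s n], invariance equates the
   measures of their level sets, and linearity pulls [h] out. *)
have It n : simple_integral mu (t n) = h (simple_integral mu (s n)).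
  have [fs ms _] := ss n; rewrite /simple_integral ranget.
  rewrite (reindex_fsbig h (range (s n))); last first.
    split=> //.
    by move=> y z _ _ /(congr1 (val k)); rewrite !kh.
  rewrite !fsbig_finite// linear_sum; apply: eq_bigr => y _.
  by rewrite linearZ preim [val k _]kh; congr (fine _ *: _); exact: haar_preimage.
have mf := measurable_elt_eval_norm (G := G) x.
(* Replace [g] by [k g] on the right, then apply the isometry [h] inside the norm: it cancels [k] in
   the orbit term and turns [s n] into [t n]. *)
have tf n : (\int[mu]_g (`|val g x - t n g|)%:E = \int[mu]_g (`|val g x - s n g|)%:E)%E.
  rewrite -[RHS](haar_integral_elt_mul k)//; last first.
    by apply/measurable_EFinP; exact: (measurable_fun_norm_sub mf (ss n)).
  apply: eq_integral => g _; congr (_%:E).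
  by rewrite -(isomG Gh) /t; congr (`| _ - _|); rewrite -[LHS]hk.
apply/eqP; rewrite -subr_eq0 -normr_le0 -lee_fin -[leRHS]adde0.
apply: (simple_integral_lim_dist mf st ss _ sf _ _ sv) => //.
  by under eq_fun do rewrite tf.
under eq_fun do rewrite It.
by apply: continuous_cvg => //; exact: clmap_continuous.
Qed.

End SymmetrizationTheory.

Theorem theorem12 (R : realType) (X : completeNormedModType R)
    (G : clgroup X) (compactG : compact [set: clgroup_elt G])
    (isomG : forall g : clmap X, clgroup_set G g -> forall x y, `|g x - g y| = `|x - y|)
    (mu : probability (borel G) R) (haar_mu : is_haar mu)
    (phi : X -> \bar R) (phi_gt0 : forall x, (0 < phi x)%E)
    (phi_proper : proper_fun phi) (phi_lsc : lsc phi)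
    (phi_bounded : bounded_below phi) (phi_inv : invariant_fun G phi)
    (phi_convex : convex_wrt mu phi)
    (eps delta : R) (eps_gt0 : 0 < eps) (delta_gt0 : 0 < delta) :
  (exists xt : X, invariant_point G xt /\
     forall x, x != xt -> (phi xt < phi x + (eps * `|x - xt|)%:E)%E) /\
  (forall x0 : X, (phi x0 < ereal_inf (range phi) + delta%:E)%E ->
     exists xt : X,
       [/\ invariant_point G xt,
           forall x, x != xt -> (phi xt < phi x + (eps * `|x - xt|)%:E)%E &
           `|symmetrization mu x0 - xt| < delta / eps]).
Proof.
have main x0 : (phi x0 < ereal_inf (range phi) + delta%:E)%E ->
    exists xt : X, [/\ invariant_point G xt,
      forall x, x != xt -> (phi xt < phi x + (eps * `|x - xt|)%:E)%E &
      `|symmetrization mu x0 - xt| < delta / eps].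
  (* Finiteness of [phi] is part of [D], so that [F] is a faithful real-valued version of [phi]
     there. *)
  move=> phix0; pose D := [set x | invariant_point G x /\ (phi x < +oo)%E].
  pose F x := fine (phi x).
  have FE x : D x -> phi x = (F x)%:E.
    by move=> [_ xoo]; rewrite fineK// ge0_fin_numE// ltW.
  have symle x : (phi (symmetrization mu x) <= phi x)%E.
    exact: symmetrization_fun_le.
  have symI x := symmetrization_invariant compactG isomG haar_mu x.
  have symD x : (phi x < +oo)%E -> D (symmetrization mu x).
    by move=> xoo; split; [exact: symI|exact: le_lt_trans (symle x) xoo].
  have D0 : D (symmetrization mu x0).
    by apply: symD; rewrite (lt_le_trans phix0)// leey.
  have FD x : D x -> 0 <= F x by move=> Dx; rewrite -lee_fin -FE// ltW.
  (* The set is an intersection of the closed fixed-point sets of the group elements with a closed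
     sublevel set of [phi]; being below [l] already implies finiteness. *)
  have lscF l : closed [set x | D x /\ F x <= l].
    rewrite (_ : [set x | _] = \bigcap_(g in clgroup_set G) [set x | g x - x = 0] `&`
        [set x | (phi x <= l%:E)%E]); last first.
      apply/seteqP; split=> x /=.
        move=> [Dx Fxl]; split; last by rewrite FE.
        by move=> g Gg /=; rewrite (Dx.1 g Gg) subrr.
      move=> [ix xl]; have Dx : D x.
        split; last by rewrite (le_lt_trans xl)// ltry.
        by move=> g /ix /= /subr0_eq.
      by split=> //; rewrite -lee_fin -FE.
    apply: closedI => //; apply: closed_bigI => g Gg.
    apply: (@preimage_closed _ _ (fun x => g x - x) [set 0]).
      by move=> x _; apply: cvgB; [exact: clmap_continuous|exact: cvg_id].
    exact/accessible_closed_set1/hausdorff_accessible/norm_hausdorff.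
  have [xt [Dxt xt_near xt_min]] := ekeland FD lscF eps_gt0 D0.
  exists xt; split; first exact: Dxt.1.
    move=> x xxt; rewrite (FE _ Dxt).
    have [xoo|] := ltP (phi x) +oo%E; last first.
      by rewrite leye_eq => /eqP ->; rewrite addye// ltry.
    have Dsx := symD x xoo.
    have Fsx : F (symmetrization mu x) <= fine (phi x).
      by rewrite -lee_fin -FE// fineK// ge0_fin_numE// ltW.
    rewrite -[phi x]fineK ?ge0_fin_numE 1?ltW// -EFinD lte_fin.
    (* If [x] symmetrizes to [xt] itself, [xt_min] says nothing, and strictness comes from the
       positive penalty [eps * |x - xt|]. *)
    have [sxt|sxt] := eqVneq (symmetrization mu x) xt.
      rewrite -sxt in xxt *; rewrite (le_lt_trans Fsx)// ltrDl mulr_gt0//.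
      by rewrite normr_gt0 subr_eq0.
    rewrite (lt_le_trans (xt_min _ Dsx sxt))// lerD// ler_pM2l//.
    exact: symmetrization_dist_le Dxt.1.
  (* Near-minimality of [x0] passes to its symmetrization, whose value is thus below
     [inf phi + delta <= F xt + delta]; [xt_near] then gives [eps] times the distance below
     [delta]. *)
  rewrite ltr_pdivlMr// mulrC.
  have : (phi (symmetrization mu x0) < (F xt + delta)%:E)%E.
    rewrite (le_lt_trans (symle _))// (lt_le_trans phix0)// EFinD leeD2r// -FE//.
    by apply: ereal_inf_lbound; exists xt.
  by rewrite FE// lte_fin; lra.
(* For the first claim, properness and positivity make the infimum finite, so some point lies within
   [delta] of it and can serve as [x0]. *)
split=> //; have [_ [x1 x1oo]] := phi_proper.
have inf_fin : ereal_inf (range phi) \is a fin_num.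
  rewrite ge0_fin_numE; last by apply/ereal_infP => _ [x _ <-]; exact: ltW.
  by apply/ereal_inf_ltP; exists (phi x1); [exists x1|rewrite ltey].
have [_ [x0 _ <-] /main[xt [ixt xt_min _]]] := lb_ereal_inf_adherent delta_gt0 inf_fin.
by exists xt.
Qed.
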